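(* Let $\Omega=\{(q_1,q_2)\in(\mathbb{R}^2)^2: q_1\neq q_2\}$, let $U:\Omega\to\mathbb{R}$ be the Lennard-Jones two-body potential $$U(q)=\frac{1}{|q_1-q_2|^{12}}-\frac{2}{|q_1-q_2|^{6}},$$ and let $q_0=(0,1/2,0,-1/2)\in\Omega$. Let $SO(2)$ act diagonally on $(\mathbb{R}^2)^2$ by $\gamma(q_1,q_2)=(\gamma q_1,\gamma q_2)$ and let $SO(2)(q_0)$ be the orbit of $q_0$. Then for every open neighbourhood $V$ of $SO(2)(q_0)$ in $\Omega$ and every $\delta>0$ there exists a non-stationary periodic solution $q(t)$ of $\ddot q(t)=-\nabla U(q(t))$ whose trajectory is contained in $V$ and whose minimal period $T$ satisfies $|T-\pi/6|<\delta$.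
   Context: Here $q_0=(0,1/2,0,-1/2)$ means $q_1=(0,1/2)$ and $q_2=(0,-1/2)$; $|\cdot|$ is the Euclidean norm. *)

(* Defs.v *)
From Stdlib Require Import Reals.
From Coquelicot Require Import Coquelicot.
Open Scope R_scope.

(* Coquelicot's norm on the product R * R is sqrt (|x|^2 + |y|^2), i.e. the
   Euclidean norm; likewise on Conf. *)
Definition Plane : Type := (R * R)%type.
Definition Conf : Type := (Plane * Plane)%type.

Definition Omega (q : Conf) : Prop := fst q <> snd q.

Definition dist12 (q : Conf) : R :=
  norm (minus (fst q) (snd q) : R * R).

(* Only the values on Omega are meaningful. *)
Definition U (q : Conf) : R := 1 / dist12 q ^ 12 - 2 / dist12 q ^ 6.

Definition q0 : Conf := ((0, 1 / 2), (0, - (1 / 2))).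

(* The neutral argument 0 of coeff_mat is only returned out of range. *)
Definition entry (A : @matrix R 2 2) (i j : nat) : R := coeff_mat 0 A i j.

Definition transpose (A : @matrix R 2 2) : @matrix R 2 2 :=
  mk_matrix 2 2 (fun i j => entry A j i).

Definition det (A : @matrix R 2 2) : R :=
  entry A 0 0 * entry A 1 1 - entry A 0 1 * entry A 1 0.

Definition SO2 (A : @matrix R_Ring 2 2) : Prop :=
  Mmult (transpose A : @matrix R_Ring 2 2) A = Mone /\ det A = 1.

Definition apply_mat (A : @matrix R 2 2) (x : Plane) : Plane :=
  (entry A 0 0 * fst x + entry A 0 1 * snd x,
   entry A 1 0 * fst x + entry A 1 1 * snd x).

Definition act (A : @matrix R 2 2) (q : Conf) : Conf :=
  (apply_mat A (fst q), apply_mat A (snd q)).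

Definition orbit (p q : Conf) : Prop :=
  exists A : @matrix R 2 2, SO2 A /\ q = act A p.

(* V is a subset of S, open for the subspace topology of S. *)
Definition open_in (S V : Conf -> Prop) : Prop :=
  exists W : Conf -> Prop,
    open (W : (R * R) * (R * R) -> Prop) /\ forall q, V q <-> W q /\ S q.

Definition inner (p q : Conf) : R :=
  fst (fst p) * fst (fst q) + snd (fst p) * snd (fst q)
  + fst (snd p) * fst (snd q) + snd (snd p) * snd (snd q).

(* g represents the Frechet derivative of f at p. *)
Definition is_gradient (f : Conf -> R) (p g : Conf) : Prop :=
  filterdiff (f : (R * R) * (R * R) -> R)
    (locally (p : (R * R) * (R * R))) (fun h => inner g h).

(* q'' = - grad U(q) on all of R, for a trajectory in Omega; v is the velocity. *)
Definition is_solution (q : R -> Conf) : Prop :=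
  exists v : R -> Conf,
    (forall t, is_derive (q : R -> (R * R) * (R * R)) t (v t)) /\
    (forall t, Omega (q t) /\
       exists g : Conf, is_gradient U (q t) g /\
         is_derive (v : R -> (R * R) * (R * R)) t
           (opp (g : (R * R) * (R * R)))).

Definition is_period (q : R -> Conf) (T : R) : Prop :=
  0 < T /\ forall t, q (t + T) = q t.

Definition is_minimal_period (q : R -> Conf) (T : R) : Prop :=
  is_period q T /\ forall S, is_period q S -> T <= S.

Definition stationary (q : R -> Conf) : Prop :=
  forall t s, q t = q s.

(* Main.v *)
Require Import Defs.
From Stdlib Require Import Reals Lra.
From Coquelicot Require Import Coquelicot.
Open Scope R_scope.

(** Along a homothetic motion [q t = r t * q0] the two bodies stay on a fixed
    line at distance [r t], and the equation of motion reduces to the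
    one-dimensional oscillator [r'' = 24 (r^-13 - r^-7)]
    ([is_solution_homothetic]).  Its equilibrium [r = 1] is [q0], and its
    linearization there has frequency 12, hence period [PI / 6].

    The oscillator can be integrated explicitly.  At energy [-E < 0] its first
    integral is [r'^2 = 2 (-E - 2 r^-12 + 4 r^-6)].  Put [u = r^6] and
    introduce the fictitious time [s] with [dt = r ds]; then
    [(du/ds)^2 = 72 (-E u^2 + 4 u - 2)], whose right-hand side is quadratic
    in [u], so [u] is a sinusoid.  With [E = 2 (1 - e^2)] and the phase
    [x = frequency e * s] this reads
<<
    r^6 = (1 + e cos x) / (1 - e^2),    dt/dx = r / frequency e,
>>
    with [frequency e = 12 sqrt (1 - e^2)]: the analogue of the eccentric
    anomaly of the Kepler problem.  Since [dt/dx] is bounded below, the phase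
    is a globally defined differentiable function of [t] ([global_inverse]),
    and [radius_solves_radial_equation] verifies the equation of motion by
    differentiation.

    The radius is [2 PI]-periodic in the phase and maximal exactly when the
    phase is a multiple of [2 PI], so the minimal period is the time of one
    revolution ([radial_oscillation]).  Both the radius and [frequency e / 12]
    tend to 1 as [e] tends to 0, uniformly in the phase; hence the period
    tends to [PI / 6] ([revolution_time_bounds]) and the trajectory shrinks to
    [q0]. *)

(** * Gradient of the potential and homothetic motions *)

Lemma dist12_pow_even (q : Conf) (n : nat) :
  dist12 q ^ (2 * n) =
  ((fst (fst q) - fst (snd q)) ^ 2 + (snd (fst q) - snd (snd q)) ^ 2) ^ n.
Proof.
rewrite pow_mult; f_equal.
destruct q as [[a b] [c d]].
unfold dist12, norm; simpl; unfold prod_norm, norm; simpl.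
unfold abs, minus, plus, opp; simpl.
rewrite !Rmult_1_r, sqrt_sqrt.
- rewrite <- !Rabs_mult, !Rabs_pos_eq; try apply Rle_0_sqr; ring.
- apply Rplus_le_le_0_compat; rewrite <- Rabs_mult; apply Rabs_pos.
Qed.

(** Only even powers of the distance occur in the potential, so it is a
    rational function of the squared distance, which is a polynomial in the
    coordinates. *)
Lemma U_square_dist (q : Conf) :
  let D := (fst (fst q) - fst (snd q)) ^ 2 + (snd (fst q) - snd (snd q)) ^ 2 in
  U q = / D ^ 6 - 2 * / D ^ 3.
Proof.
intros D; unfold U.
rewrite (dist12_pow_even q 6 : dist12 q ^ 12 = _).
rewrite (dist12_pow_even q 3 : dist12 q ^ 6 = _).
unfold Rdiv; fold D; ring.
Qed.

Lemma filterdiff_square {V : NormedModule R_AbsRing} (f l : V -> R) (x : V) :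
  filterdiff f (locally x) l ->
  filterdiff (fun y => f y ^ 2) (locally x) (fun h => 2 * f x * l h).
Proof.
intros Hf.
apply filterdiff_ext_lin with (fun h => l h * f x + f x * l h).
- apply filterdiff_ext with (fun y => f y * f y).
  { intros y; change (@eq R (f y * f y) (f y ^ 2)); ring. }
  apply (filterdiff_mult_fct (K := R_AbsRing) f f x l l Rmult_comm Hf Hf).
- intros h; change (@eq R (l h * f x + f x * l h) (2 * f x * l h)); ring.
Qed.

Lemma filterdiff_gap (p : R * R -> R) (q : (R * R) * (R * R)) :
  is_linear p ->
  filterdiff (fun q => p (fst q) - p (snd q)) (locally q)
    (fun h => p (fst h) - p (snd h)).
Proof.
intros Hp.
apply (filterdiff_minus_fct (K := R_AbsRing) (V := R_NormedModule)
  (fun q : (R * R) * (R * R) => p (fst q)) (fun q => p (snd q))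
  (fun q => p (fst q)) (fun q => p (snd q))); apply filterdiff_linear.
- exact (is_linear_comp (fun q : (R * R) * (R * R) => fst q) p is_linear_fst Hp).
- exact (is_linear_comp (fun q : (R * R) * (R * R) => snd q) p is_linear_snd Hp).
Qed.

(** With [F D = D^-6 - 2 D^-3], the factor is [k = 2 F'(D)]: the other 2 comes
    from the derivative of the squares. *)
Lemma is_gradient_U (a b c d : R) :
  let D := (a - c) ^ 2 + (b - d) ^ 2 in
  let k := 12 * (/ D ^ 4 - / D ^ 7) in
  0 < D ->
  is_gradient U ((a, b), (c, d))
    ((k * (a - c), k * (b - d)), (k * (c - a), k * (d - b))).
Proof.
intros D k HD; unfold is_gradient.
set (q := ((a, b), (c, d)) : (R * R) * (R * R)).
set (gx := fun q : (R * R) * (R * R) => fst (fst q) - fst (snd q)).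
set (gy := fun q : (R * R) * (R * R) => snd (fst q) - snd (snd q)).
assert (HdD := filterdiff_plus_fct _ _ _ _
  (filterdiff_square gx gx q (filterdiff_gap fst q is_linear_fst))
  (filterdiff_square gy gy q (filterdiff_gap snd q is_linear_snd))).
assert (HF : is_derive (fun z => / z ^ 6 - 2 * / z ^ 3) D
               (6 * (/ D ^ 4 - / D ^ 7))).
{ auto_derive.
  - assert (0 < D ^ 6) by now apply pow_lt.
    assert (0 < D ^ 3) by now apply pow_lt.
    simpl in *; repeat split; lra.
  - field; lra. }
apply filterdiff_ext with
  (fun q => / (gx q ^ 2 + gy q ^ 2) ^ 6 - 2 * / (gx q ^ 2 + gy q ^ 2) ^ 3).
{ intros p; symmetry; apply U_square_dist. }
eapply filterdiff_ext_lin.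
- exact (filterdiff_comp' _ (fun z => / z ^ 6 - 2 * / z ^ 3) q _ _ HdD HF).
- intros [[h1 h2] [h3 h4]]; unfold inner, gx, gy, k; simpl.
  unfold scal, plus; simpl; unfold mult; simpl; ring.
Qed.

(** The gradient at [r * q0] is a multiple of [q0] itself, so the line through
    [q0] is invariant. *)
Lemma is_solution_homothetic (r w : R -> R) :
  (forall t, 0 < r t) ->
  (forall t, is_derive r t (w t)) ->
  (forall t, is_derive w t (24 * (/ r t ^ 13 - / r t ^ 7))) ->
  is_solution (fun t => scal (r t) (q0 : (R * R) * (R * R))).
Proof.
intros Hpos Hr Hw.
exists (fun t => scal (w t) (q0 : (R * R) * (R * R))); split.
- intros t; exact (is_derive_scal_l r t _ (q0 : (R * R) * (R * R)) (Hr t)).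
- intros t; specialize (Hpos t); split.
  { intros H; apply (f_equal snd) in H; simpl in H.
    change (r t * (1 / 2) = r t * - (1 / 2)) in H; lra. }
  set (D := (r t * 0 - r t * 0) ^ 2 + (r t * (1 / 2) - r t * - (1 / 2)) ^ 2).
  assert (HD : D = r t ^ 2) by (unfold D; field).
  assert (HD0 : 0 < D) by (rewrite HD; now apply pow_lt).
  eexists; split; [exact (is_gradient_U _ _ _ _ HD0)|].
  fold D; rewrite HD; clear D HD HD0.
  assert (Hd := is_derive_scal_l w t _ (q0 : (R * R) * (R * R)) (Hw t)).
  match goal with |- is_derive _ _ ?g =>
    match type of Hd with is_derive _ _ ?g' => replace g with g'; [exact Hd|] end
  end.
  apply injective_projections; apply injective_projections; simpl.
  all: unfold scal, opp; simpl; unfold mult; simpl.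
  all: match goal with |- ?x = ?y => change (@eq R x y) end.
  all: field; lra.
Qed.

(** * Inverting a function whose derivative is bounded below *)

Lemma mean_value (G g : R -> R) (x y : R) :
  (forall z, is_derive G z (g z)) -> exists z, G y - G x = g z * (y - x).
Proof.
intros HG.
destruct (MVT_gen G x y g) as [z [_ Hz]].
- intros z _; apply HG.
- intros z _; apply continuity_pt_filterlim.
  apply (ex_derive_continuous (V := R_NormedModule)); eexists; apply HG.
- now exists z.
Qed.

(** A derivative at least [c > 0] makes [G] expand distances by the factor [c].
    This gives injectivity, surjectivity through the intermediate value
    theorem, and a Lipschitz inverse, for which the difference quotients of
    the inverse are the inverses of those of [G]. *)
Lemma global_inverse (G g : R -> R) (c : R) :
  0 < c ->
  (forall x, is_derive G x (g x)) ->
  (forall x, c <= g x) ->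
  exists H : R -> R,
    (forall t, G (H t) = t) /\
    (forall x, H (G x) = x) /\
    (forall t, is_derive H t (/ g (H t))).
Proof.
intros Hc HG Hg.
assert (Hexp : forall x y, c * Rabs (y - x) <= Rabs (G y - G x)).
{ intros x y; destruct (mean_value G g x y HG) as [z ->].
  rewrite Rabs_mult, (Rabs_pos_eq (g z)); [|specialize (Hg z); lra].
  apply Rmult_le_compat_r; [apply Rabs_pos | apply Hg]. }
assert (Hinj : forall x y, G x = G y -> x = y).
{ intros x y Hxy; specialize (Hexp x y).
  rewrite Hxy, Rminus_diag, Rabs_R0 in Hexp.
  assert (Rabs (y - x) <= 0) by (apply Rmult_le_reg_l with c; lra).
  destruct (Req_dec (y - x) 0) as [|Hne]; [lra|].
  apply Rabs_pos_lt in Hne; lra. }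
assert (Hsurj : forall t, {x | G x = t}).
{ intros t; set (b := Rabs (t - G 0) / c).
  assert (Hb : 0 <= b) by (apply Rdiv_le_0_compat; [apply Rabs_pos | lra]).
  assert (Hcb : c * b = Rabs (t - G 0)) by (unfold b; field; lra).
  assert (Hlow : forall x, 0 <= x -> c * x <= G x - G 0 /\ c * x <= G 0 - G (- x)).
  { intros x Hx; split.
    - destruct (mean_value G g 0 x HG) as [z ->].
      rewrite Rminus_0_r; apply Rmult_le_compat_r; auto.
    - destruct (mean_value G g (- x) 0 HG) as [z ->].
      replace (0 - - x) with x by ring; apply Rmult_le_compat_r; auto. }
  destruct (Hlow b Hb) as [H1 H2]; rewrite Hcb in H1, H2.
  assert (H3 := Rle_abs (t - G 0)).
  assert (H4 := Rle_abs (- (t - G 0))); rewrite Rabs_Ropp in H4.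
  (* By expansion, [G] has crossed the level [t] within distance [b] of 0. *)
  destruct (IVT_gen G (- b) b t) as [x [_ Hx]].
  - intros x; apply continuity_pt_filterlim.
    apply (ex_derive_continuous (V := R_NormedModule)); eexists; apply HG.
  - rewrite Rmin_left, Rmax_right; lra.
  - now exists x. }
exists (fun t => proj1_sig (Hsurj t)).
assert (HGH : forall t, G (proj1_sig (Hsurj t)) = t)
  by (intros t; apply (proj2_sig (Hsurj t))).
split; [exact HGH|split]; [intros x; apply Hinj, HGH|].
intros t; apply is_derive_Reals; intros eps Heps.
set (x := proj1_sig (Hsurj t)).
assert (Hgx := Hg x).
(* A quotient [s] within [eps * c^2] of [g x] has its inverse within [eps] of
   that of [g x], because both are at least [c] in absolute value. *)
assert (Heps' : 0 < eps * (c * c)) by (repeat apply Rmult_lt_0_compat; lra).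
destruct (proj1 (is_derive_Reals G x (g x)) (HG x) _ Heps') as [d Hd].
assert (Hcd : 0 < c * d) by (apply Rmult_lt_0_compat; [lra | apply cond_pos]).
exists (mkposreal _ Hcd); simpl; intros h Hh0 Hh.
fold x; set (k := proj1_sig (Hsurj (t + h)) - x).
assert (Hxk : G (x + k) - G x = h).
{ unfold k, x; replace (_ + _) with (proj1_sig (Hsurj (t + h))) by ring.
  rewrite !HGH; ring. }
assert (Hk0 : k <> 0).
{ intros Hk; apply Hh0; rewrite <- Hxk, Hk, Rplus_0_r; ring. }
assert (Hk := Hexp x (x + k)).
rewrite Hxk in Hk; replace (x + k - x) with k in Hk by ring.
assert (Hkd : Rabs k < d) by (apply Rmult_lt_reg_l with c; lra).
specialize (Hd k Hk0 Hkd); rewrite Hxk in Hd.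
set (s := h / k) in Hd.
assert (Hs : c <= Rabs s).
{ unfold s, Rdiv; rewrite Rabs_mult, Rabs_inv.
  apply Rmult_le_reg_r with (Rabs k); [now apply Rabs_pos_lt|].
  rewrite Rmult_assoc, Rinv_l; [lra | now apply Rabs_no_R0]. }
assert (Hs0 : s <> 0) by (intros E; rewrite E, Rabs_R0 in Hs; lra).
replace (k / h - / g x) with (- (s - g x) * / (s * g x))
  by (unfold s; field; repeat split; lra).
rewrite Rabs_mult, Rabs_Ropp, Rabs_inv, Rabs_mult, (Rabs_pos_eq (g x)) by lra.
apply Rmult_lt_reg_r with (Rabs s * g x); [apply Rmult_lt_0_compat; lra|].
rewrite Rmult_assoc, Rinv_l by (apply Rgt_not_eq, Rmult_lt_0_compat; lra).
rewrite Rmult_1_r; apply Rlt_le_trans with (1 := Hd).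
apply Rmult_le_compat_l; [lra|]; apply Rmult_le_compat; lra.
Qed.

(** * The radial oscillation parametrized by its phase *)

(** The distance of the bodies at phase [x]; [e] plays the role of an
    eccentricity, the sixth powers of the extreme distances being
    [1 / (1 - e)] and [1 / (1 + e)]. *)
Definition radius (e x : R) : R := Rpower ((1 + e * cos x) / (1 - e ^ 2)) (1 / 6).

(** The rate of the phase with respect to the fictitious time [s], where
    [dt = r ds]. *)
Definition frequency (e : R) : R := 12 * sqrt (1 - e ^ 2).

Lemma eccentric_pos (e x : R) : 0 < e < 1 -> 0 < 1 + e * cos x.
Proof.
intros He; assert (Hx := COS_bound x).
assert (e * -1 <= e * cos x) by (apply Rmult_le_compat_l; lra); lra.
Qed.

Lemma radius_pos (e x : R) : 0 < radius e x.
Proof. apply exp_pos. Qed.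

Lemma radius_pow6 (e x : R) :
  0 < e < 1 -> radius e x ^ 6 = (1 + e * cos x) / (1 - e ^ 2).
Proof.
intros He; unfold radius.
rewrite <- Rpower_pow, Rpower_mult by apply exp_pos.
replace (1 / 6 * INR 6) with 1 by (simpl; field).
apply Rpower_1, Rdiv_lt_0_compat; [now apply eccentric_pos | nra].
Qed.

(** The bounds hold for the sixth power of the radius; as they lie on either
    side of 1, they pass to the radius, which is nearer to 1. *)
Lemma radius_bounds (e x : R) :
  0 < e < 1 -> / (1 + e) <= radius e x <= / (1 - e).
Proof.
intros He; assert (Hr := radius_pos e x); assert (H6 := radius_pow6 e x He).
assert (Hx := COS_bound x).
assert (Hlo : radius e x ^ 6 * (1 + e) >= 1).
{ rewrite H6; apply Rle_ge, Rmult_le_reg_r with (1 - e); [lra|].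
  replace (_ / _ * _ * _) with (1 + e * cos x) by (field; nra); nra. }
assert (Hhi : radius e x ^ 6 * (1 - e) <= 1).
{ rewrite H6; apply Rmult_le_reg_r with (1 + e); [lra|].
  replace (_ / _ * _ * _) with (1 + e * cos x) by (field; nra); nra. }
split.
- apply Rmult_le_reg_r with (1 + e); [lra|]; rewrite Rinv_l by lra.
  destruct (Rle_lt_dec 1 (radius e x)) as [H1|H1]; [nra|].
  assert (radius e x ^ 5 <= 1) by (rewrite <- (pow1 5); apply pow_incr; lra).
  assert (radius e x ^ 6 <= radius e x) by (simpl in *; nra); nra.
- apply Rmult_le_reg_r with (1 - e); [lra|]; rewrite Rinv_l by lra.
  destruct (Rle_lt_dec (radius e x) 1) as [H1|H1]; [nra|].
  assert (1 <= radius e x ^ 5) by (apply pow_R1_Rle; lra).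
  assert (radius e x <= radius e x ^ 6) by (simpl in *; nra); nra.
Qed.

Lemma is_derive_radius (e x : R) :
  0 < e < 1 ->
  is_derive (radius e) x
    (- (e * sin x) / (6 * (1 + e * cos x)) * radius e x).
Proof.
intros He; assert (Hp := eccentric_pos e x He).
unfold radius, Rpower; auto_derive.
- apply Rdiv_lt_0_compat; [exact Hp | nra].
- change (e * (e * 1)) with (e ^ 2); fold (1 - e ^ 2); unfold Rdiv.
  field; split; nra.
Qed.

Lemma frequency_pos (e : R) : 0 < e < 1 -> 0 < frequency e.
Proof.
intros He; apply Rmult_lt_0_compat; [lra | apply sqrt_lt_R0; nra].
Qed.

(** In [r'] the radius cancels, leaving a function of the phase alone:
    [r' = - frequency e * e sin x / (6 (1 + e cos x))].  In [r''] one uses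
    [e (e + cos x) = (1 - e^2) (r^6 - 1)] and [1 + e cos x = (1 - e^2) r^6]. *)
Lemma radius_solves_radial_equation (e : R) (th : R -> R) :
  0 < e < 1 ->
  (forall t, is_derive th t (frequency e / radius e (th t))) ->
  exists w : R -> R,
    (forall t, is_derive (fun t => radius e (th t)) t (w t)) /\
    (forall t, is_derive w t
       (24 * (/ radius e (th t) ^ 13 - / radius e (th t) ^ 7))).
Proof.
intros He Hth.
exists (fun t => - (frequency e * e * sin (th t)) / (6 * (1 + e * cos (th t)))).
split; intros t; assert (Hp := eccentric_pos e (th t) He);
  assert (Hr := radius_pos e (th t)).
- replace (- (frequency e * e * sin (th t)) / (6 * (1 + e * cos (th t)))) with
    (scal (frequency e / radius e (th t))
      (- (e * sin (th t)) / (6 * (1 + e * cos (th t))) * radius e (th t))).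
  + apply (is_derive_comp (radius e) th); [now apply is_derive_radius | apply Hth].
  + unfold scal; simpl; unfold mult; simpl; field; lra.
- assert (Hw : is_derive
    (fun x => - (frequency e * e * sin x) / (6 * (1 + e * cos x))) (th t)
    (- (frequency e * e * (cos (th t) + e)) / (6 * (1 + e * cos (th t)) ^ 2))).
  { auto_derive; [lra|].
    replace (cos (th t) + e)
      with (cos (th t) + e * ((sin (th t)) ^ 2 + (cos (th t)) ^ 2)).
    - field; lra.
    - rewrite <- !Rsqr_pow2, sin2_cos2; ring. }
  assert (Hcomp := is_derive_comp _ th t _ _ Hw (Hth t)).
  replace (24 * _) with
    (scal (frequency e / radius e (th t))
      (- (frequency e * e * (cos (th t) + e)) / (6 * (1 + e * cos (th t)) ^ 2))).
  { exact Hcomp. }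
  match goal with |- scal ?a ?b = ?c => change (@eq R (a * b) c) end.
  assert (H6 := radius_pow6 e (th t) He).
  assert (Hf : frequency e ^ 2 = 144 * (1 - e ^ 2)).
  { unfold frequency; rewrite Rpow_mult_distr, pow2_sqrt by nra; ring. }
  replace (/ radius e (th t) ^ 13 - / radius e (th t) ^ 7) with
    ((1 - radius e (th t) ^ 6) / (radius e (th t) ^ 6) ^ 2 / radius e (th t))
    by (field; lra).
  replace (frequency e / radius e (th t) * _) with
    (- (frequency e ^ 2 * e * (cos (th t) + e)) / (6 * (1 + e * cos (th t)) ^ 2)
     / radius e (th t)) by (field; lra).
  rewrite H6, Hf; field; repeat split; nra.
Qed.

(** * Period of the oscillation *)

Definition elapsed_time (e x : R) : R :=
  RInt (fun y => radius e y / frequency e) 0 x.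

Lemma continuous_time_density (e x : R) :
  0 < e < 1 -> continuous (fun y => radius e y / frequency e) x.
Proof.
intros He; apply (ex_derive_continuous (V := R_NormedModule)).
apply ex_derive_mult; [eexists; now apply is_derive_radius | apply ex_derive_const].
Qed.

Lemma ex_RInt_time_density (e a b : R) :
  0 < e < 1 -> ex_RInt (fun y => radius e y / frequency e) a b.
Proof.
intros He; apply (ex_RInt_continuous (V := R_CompleteNormedModule)).
intros x _; now apply continuous_time_density.
Qed.

Lemma is_derive_elapsed_time (e x : R) :
  0 < e < 1 -> is_derive (elapsed_time e) x (radius e x / frequency e).
Proof.
intros He.
apply (is_derive_RInt (V := R_NormedModule)
  (fun y => radius e y / frequency e) (elapsed_time e) 0 x).
- apply filter_forall; intros y.
  apply (RInt_correct (V := R_CompleteNormedModule)).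
  now apply ex_RInt_time_density.
- now apply continuous_time_density.
Qed.

Lemma elapsed_time_revolution (e x : R) :
  0 < e < 1 ->
  elapsed_time e (x + 2 * PI) = elapsed_time e x + elapsed_time e (2 * PI).
Proof.
intros He; unfold elapsed_time.
rewrite <- (RInt_Chasles (V := R_CompleteNormedModule) _ 0 (2 * PI) (x + 2 * PI))
  by now apply ex_RInt_time_density.
rewrite Rplus_comm; apply (f_equal2 Rplus); [|reflexivity].
assert (Hlin := RInt_comp_lin (V := R_CompleteNormedModule)
  (fun y => radius e y / frequency e) 1 (2 * PI) 0 x).
rewrite Rmult_0_r, Rplus_0_l, Rmult_1_l in Hlin.
rewrite <- Hlin by now apply ex_RInt_time_density.
apply (RInt_ext (V := R_CompleteNormedModule)); intros y _.
unfold scal; simpl; unfold mult; simpl; unfold radius.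
rewrite !Rmult_1_l, cos_plus, cos_2PI, sin_2PI.
now replace (cos y * 1 - sin y * 0) with (cos y) by ring.
Qed.

(** By the mean value theorem the revolution takes the time
    [2 PI / frequency e * radius e z = PI / 6 * (radius e z / sqrt (1 - e^2))]
    for some phase [z]. *)
Lemma revolution_time_bounds (e : R) :
  0 < e <= 1 / 4 ->
  PI / 6 * (1 - e) <= elapsed_time e (2 * PI) <= PI / 6 * (1 + 4 * e).
Proof.
intros He; assert (He1 : 0 < e < 1) by lra.
destruct (mean_value (elapsed_time e) (fun x => radius e x / frequency e) 0 (2 * PI))
  as [z Hz]; [intros z; now apply is_derive_elapsed_time|].
assert (H0 : elapsed_time e 0 = 0)
  by apply (RInt_point (V := R_CompleteNormedModule)).
rewrite H0 in Hz.
set (s := sqrt (1 - e ^ 2)).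
assert (Hs2 : s * s = 1 - e ^ 2) by (apply sqrt_sqrt; nra).
assert (Hs0 : 0 < s) by (apply sqrt_lt_R0; nra).
assert (Hs1 : 1 - e <= s <= 1) by (split; nra).
replace (elapsed_time e (2 * PI)) with (PI / 6 * (radius e z / s)).
2:{ replace (elapsed_time e (2 * PI))
      with (radius e z / frequency e * (2 * PI - 0)) by lra.
    unfold frequency; fold s; field; lra. }
assert (Hb := radius_bounds e z He1).
assert (H1 : 1 <= (1 + e) * radius e z).
{ replace 1 with ((1 + e) * / (1 + e)) at 1 by (field; lra).
  apply Rmult_le_compat_l; lra. }
assert (H2 : (1 - e) * radius e z <= 1).
{ replace 1 with ((1 - e) * / (1 - e)) at 2 by (field; lra).
  apply Rmult_le_compat_l; lra. }
assert (HPI := PI_RGT_0).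
split; apply Rmult_le_compat_l; try lra;
  apply Rmult_le_reg_r with s; try assumption;
  replace (radius e z / s * s) with (radius e z) by (field; lra).
- nra.
- assert (radius e z <= (1 + 4 * e) * (1 - e)); [|nra].
  apply Rmult_le_reg_l with (1 - e); nra.
Qed.

Lemma cos_eq_1_first (x : R) : 0 < x -> cos x = 1 -> 2 * PI <= x.
Proof.
intros Hx Hc; apply Rnot_lt_le; intros Hlt.
replace x with (2 * (x / 2)) in Hc by field; rewrite cos_2a_sin in Hc.
assert (0 < sin (x / 2)) by (apply sin_gt_0; lra).
nra.
Qed.

(** The motion starts at phase 0, where the distance is maximal.  A period
    brings the distance back to its maximum, hence the cosine of the phase
    back to 1, which takes at least a full revolution. *)
Lemma radial_oscillation (e : R) :
  0 < e < 1 ->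
  exists r : R -> R,
    is_solution (fun t => scal (r t) (q0 : (R * R) * (R * R))) /\
    is_minimal_period (fun t => scal (r t) (q0 : (R * R) * (R * R)))
      (elapsed_time e (2 * PI)) /\
    forall t, / (1 + e) <= r t <= / (1 - e).
Proof.
intros He.
assert (Hw := frequency_pos e He).
assert (Hpos : 0 < / (1 + e)) by (apply Rinv_0_lt_compat; lra).
destruct (global_inverse (elapsed_time e) (fun x => radius e x / frequency e)
  (/ (1 + e) / frequency e)) as [th [Hright [Hleft Hth]]].
{ now apply Rdiv_lt_0_compat. }
{ intros x; now apply is_derive_elapsed_time. }
{ intros x; apply Rmult_le_compat_r.
  - now apply Rlt_le, Rinv_0_lt_compat.
  - now apply radius_bounds. }
assert (H0 : elapsed_time e 0 = 0)
  by apply (RInt_point (V := R_CompleteNormedModule)).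
assert (Hincr : forall x y, elapsed_time e x < elapsed_time e y -> x < y).
{ intros x y Hxy; destruct (mean_value (elapsed_time e)
    (fun x => radius e x / frequency e) x y) as [z Hz];
    [intros z; now apply is_derive_elapsed_time|].
  assert (0 < radius e z / frequency e)
    by (apply Rdiv_lt_0_compat; [apply radius_pos | exact Hw]).
  nra. }
destruct (radius_solves_radial_equation e th He) as [w [Hr Hrw]].
{ intros t; replace (frequency e / radius e (th t))
    with (/ (radius e (th t) / frequency e)); [apply Hth|].
  assert (Hrp := radius_pos e (th t)); field; lra. }
exists (fun t => radius e (th t)); split; [|split; [split; [split|]|]].
- apply is_solution_homothetic with w; auto; intros t; apply radius_pos.
- rewrite <- H0.
  destruct (mean_value (elapsed_time e) (fun x => radius e x / frequency e) 0 (2 * PI))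
    as [z Hz]; [intros z; now apply is_derive_elapsed_time|].
  assert (0 < radius e z / frequency e)
    by (apply Rdiv_lt_0_compat; [apply radius_pos | exact Hw]).
  assert (HPI := PI_RGT_0); nra.
- intros t; f_equal.
  replace (th (t + elapsed_time e (2 * PI))) with (th t + 2 * PI).
  + unfold radius; rewrite cos_plus, cos_2PI, sin_2PI.
    now replace (cos (th t) * 1 - sin (th t) * 0) with (cos (th t)) by ring.
  + rewrite <- (Hleft (th t + 2 * PI)), elapsed_time_revolution, Hright by exact He.
    reflexivity.
- intros S [HS Hper].
  assert (Hth0 := Hleft 0); rewrite H0 in Hth0.
  assert (HthS : 0 < th S) by (apply Hincr; rewrite H0, Hright; exact HS).
  assert (Hrad : radius e (th S) = radius e 0).
  { specialize (Hper 0); rewrite Rplus_0_l, Hth0 in Hper.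
    apply (f_equal fst), (f_equal snd) in Hper; simpl in Hper.
    change (radius e (th S) * (1 / 2) = radius e 0 * (1 / 2)) in Hper; lra. }
  assert (Hcos : cos (th S) = 1).
  { apply (f_equal (fun x => x ^ 6)) in Hrad.
    rewrite !radius_pow6, cos_0 in Hrad by exact He.
    apply Rmult_eq_reg_r in Hrad; [nra|].
    apply Rinv_neq_0_compat; nra. }
  rewrite <- (Hright S); apply Rnot_lt_le; intros Hlt.
  apply Hincr in Hlt; assert (Hrev := cos_eq_1_first _ HthS Hcos); lra.
- intros t; now apply radius_bounds.
Qed.

(** * Small oscillations near the equilibrium *)

Lemma q0_in_orbit : orbit q0 q0.
Proof.
exists (Mone : @matrix R_Ring 2 2); split; [split|].
- replace (transpose (Mone : @matrix R_Ring 2 2)) with (Mone : @matrix R_Ring 2 2).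
  + apply Mmult_one_l.
  + reflexivity.
- cbv -[Rplus Rmult Ropp IZR Rminus]; ring.
- apply injective_projections; apply injective_projections;
    cbv -[Rplus Rmult Ropp IZR Rminus Rdiv]; ring.
Qed.


Lemma neighbourhood_contains_homotheties (V : Conf -> Prop) :
  open_in Omega V -> V q0 ->
  exists eta : R, 0 < eta /\
    forall r, 0 < r -> Rabs (r - 1) < eta ->
      V (scal r (q0 : (R * R) * (R * R))).
Proof.
intros [W [HW HVW]] HV.
destruct (HW q0 (proj1 (proj1 (HVW q0) HV))) as [eta Heta].
exists eta; split; [apply cond_pos|]; intros r Hr Hclose.
apply HVW; split.
- apply Heta.
  assert (Hb : forall a, Rabs a <= 1 -> ball (a : R_UniformSpace) eta (scal r a)).
  { intros a Ha; change (Rabs (r * a - a) < eta).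
    replace (r * a - a) with ((r - 1) * a) by ring; rewrite Rabs_mult.
    assert (H1 := Rabs_pos (r - 1)); assert (H2 := Rabs_pos a); nra. }
  split; split; apply Hb; simpl; apply Rabs_le; lra.
- intros H; apply (f_equal snd) in H; simpl in H.
  change (r * (1 / 2) = r * - (1 / 2)) in H; lra.
Qed.

Theorem mainTheorem2 :
  forall V : Conf -> Prop,
    open_in Omega V ->
    (forall q, orbit q0 q -> V q) ->
    forall delta : R, 0 < delta ->
    exists (q : R -> Conf) (T : R),
      is_solution q /\
      ~ stationary q /\
      is_minimal_period q T /\
      (forall t, V (q t)) /\
      Rabs (T - PI / 6) < delta.
Proof.
intros V HV Horb delta Hdelta.
destruct (neighbourhood_contains_homotheties V HV) as [eta [Heta Hnear]].
{ apply Horb, q0_in_orbit. }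
(* The trajectory lies at ratio within [2 m] of 1, and the period differs from
   [PI / 6] by at most [4 m * PI / 6 < 4 m]. *)
set (m := Rmin (1 / 4) (Rmin (eta / 4) (delta / 8))).
assert (Hm : 0 < m) by (repeat apply Rmin_pos; lra).
assert (Hm1 : m <= 1 / 4) by apply Rmin_l.
assert (Hm2 : m <= Rmin (eta / 4) (delta / 8)) by apply Rmin_r.
assert (Hm3 := Rmin_l (eta / 4) (delta / 8)).
assert (Hm4 := Rmin_r (eta / 4) (delta / 8)).
destruct (radial_oscillation m) as [r [Hsol [Hmin Hr]]]; [lra|].
exists (fun t => scal (r t) (q0 : (R * R) * (R * R))), (elapsed_time m (2 * PI)).
split; [exact Hsol|split; [|split; [exact Hmin|split]]].
- intros Hstat; destruct Hmin as [[HT _] Hleast].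
  assert (H := Hleast (elapsed_time m (2 * PI) / 2)).
  cut (elapsed_time m (2 * PI) <= elapsed_time m (2 * PI) / 2); [lra|].
  apply H; split; [lra | intros t; apply Hstat].
- intros t; destruct (Hr t) as [H1 H2].
  assert (H3 : 1 - m <= / (1 + m)).
  { apply Rmult_le_reg_r with (1 + m); [lra|]; rewrite Rinv_l by lra; nra. }
  assert (H4 : / (1 - m) <= 1 + 2 * m).
  { apply Rmult_le_reg_r with (1 - m); [lra|]; rewrite Rinv_l by lra; nra. }
  apply Hnear; [lra|]; apply Rabs_def1; lra.
- destruct (revolution_time_bounds m) as [H1 H2]; [lra|].
  assert (HPI := PI_4); assert (HPI0 := PI_RGT_0).
  apply Rabs_def1; nra.
Qed.
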